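(* Let $(X,T)$ be a dynamical system with the shadowing property and let $Y\subseteq X$ be a chain recurrent class. If $\Phi\in\mathcal{C}(X,\mathbb{R})$ is such that there exist $\mu_1,\mu_2\in\mathcal{M}_e(Y)$ with $$\int\Phi\,d\mu_1\neq\int\Phi\,d\mu_2,$$ then $h_{\mathrm{top}}(T,I_\Phi(T))\geq h_{\mathrm{top}}(T,Y)$.
   Context: A dynamical system $(X,T)$ is a compact metric space $(X,d)$ together with a continuous map $T:X\to X$. $\mathcal{C}(X,\mathbb{R})$ is the set of continuous functions $X\to\mathbb{R}$. For $\delta>0$, a sequence $\{x_n\}_{n\ge 0}\subseteq X$ is a $\delta$-pseudo-orbit if $d(Tx_n,x_{n+1})<\delta$ for all $n\geq 0$; a finite one $\{x_i\}_{i=0}^k$, with $k\ge1$, is a $\delta$-chain from $x_0$ to $x_k$. $(X,T)$ has the shadowing property if for every $\varepsilon>0$ there is $\delta>0$ such that for every $\delta$-pseudo-orbit $\{x_n\}_{n\ge 0}$ there is $y\in X$ with $d(T^ny,x_n)<\varepsilon$ for all $n\geq 0$. Points $x,y\in X$ are chain related if for every $\varepsilon>0$ there are an $\varepsilon$-chain from $x$ to $y$ and an $\varepsilon$-chain from $y$ to $x$. A point is chain recurrent if it is chain related to itself. Chain relatedness is an equivalence relation on the set $CR(X)$ of chain recurrent points, and its equivalence classes are the chain recurrent classes; each is closed and satisfies $T(Y)\subseteq Y$. $\mathcal{M}_e(Y)$ is the set of ergodic $T$-invariant Borel probability measures supported on $Y$. The $\Phi$-irregular set $I_\Phi(T)$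 is the set of $x\in X$ for which $\lim_{n\to\infty}\frac1n\sum_{i=0}^{n-1}\Phi(T^ix)$ does not exist. $h_{\mathrm{top}}(T,E)$ is the Bowen topological entropy of a (not necessarily compact or invariant) set $E\subseteq X$: let $B_n(x,\varepsilon)=\{y\in X:\max_{0\le j\le n-1}d(T^jx,T^jy)<\varepsilon\}$; let $\mathcal{G}_n(E,\varepsilon)$ be the collection of all finite or countable coverings of $E$ by balls $B_v(x,\varepsilon)$ with $v\geq n$; put $C(E;t,n,\varepsilon,T)=\inf_{C\in\mathcal{G}_n(E,\varepsilon)}\sum_{B_v(x,\varepsilon)\in C}e^{-tv}$, $C(E;t,\varepsilon,T)=\lim_{n\to\infty}C(E;t,n,\varepsilon,T)$, $h_{\mathrm{top}}(E,\varepsilon,T)=\inf\{t:C(E;t,\varepsilon,T)=0\}$ and $h_{\mathrm{top}}(T,E)=\lim_{\varepsilon\to0}h_{\mathrm{top}}(E,\varepsilon,T)$. *)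

(* Defs.v *)
From HB Require Import structures.
From mathcomp Require Export all_boot all_order all_algebra.
From mathcomp Require Export all_classical all_reals all_analysis.

Set Implicit Arguments.
Unset Strict Implicit.
Unset Printing Implicit Defensive.

Import Order.TTheory GRing.Theory Num.Theory.
Import numFieldNormedType.Exports.

Local Open Scope classical_set_scope.
Local Open Scope ring_scope.

(* The library's measurable types are pointed, so a metric space carrying
   Borel measures has to be pointed too, i.e., nonempty. *)
#[short(type="pointedMetricType")]
HB.structure Definition PointedMetric (R : numDomainType) :=
  {X of Pointed X & Metric R X}.

Definition borelType (R : numDomainType) (X : pointedMetricType R) :=
  g_sigma_algebraType (@open X).

Section PseudoOrbits.
Context {R : realType} {X : metricType R}.
Implicit Types (T : X -> X) (x y : X) (delta : R) (u : nat -> X) (Y : set X).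

Definition pseudo_orbit T delta u :=
  forall n, mdist (T (u n)) (u n.+1) < delta.

Definition shadowing T :=
  forall eps : R, 0 < eps -> exists2 delta : R, 0 < delta &
    forall u, pseudo_orbit T delta u ->
      exists y, forall n, mdist (iter n T y) (u n) < eps.

(* The chain consists of u 0, ..., u k; later values of u are irrelevant. *)
Definition chain T delta x y :=
  exists k u, [/\ (1 <= k)%N, u 0%N = x, u k = y &
    forall i, (i < k)%N -> mdist (T (u i)) (u i.+1) < delta].

Definition chain_related T x y :=
  forall eps : R, 0 < eps -> chain T eps x y /\ chain T eps y x.

Definition chain_recurrent T : set X := [set x | chain_related T x x].

Definition chain_recurrent_class T Y :=
  exists2 x, chain_recurrent T x &
    Y = [set y | chain_recurrent T y /\ chain_related T x y].

Definition birkhoff_average T (Phi : X -> R) (n : nat) x : R :=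
  n%:R^-1 * \sum_(0 <= i < n) Phi (iter i T x).

Definition irregular_set T (Phi : X -> R) : set X :=
  [set x | ~ cvg (birkhoff_average T Phi n x @[n --> \oo])].

End PseudoOrbits.

Section ErgodicMeasures.
Context {R : realType} {X : pointedMetricType R}.
Implicit Types (T : X -> X) (mu : probability (borelType X) R) (Y : set X).

Definition invariant_measure T mu :=
  forall A : set (borelType X), measurable A -> mu (T @^-1` A) = mu A.

Definition ergodic T mu :=
  forall A : set (borelType X), measurable A -> T @^-1` A = A ->
    mu A = 0%E \/ mu A = 1%E.

Definition ergodic_measures T Y : set (probability (borelType X) R) :=
  [set mu | [/\ invariant_measure T mu, ergodic T mu & mu Y = 1%E]].

End ErgodicMeasures.

Section BowenEntropy.
Context {R : realType} {X : metricType R}.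
Implicit Types (T : X -> X) (x : X) (E : set X) (eps t : R) (n : nat).

(* Distances are nonnegative, so 0 is the neutral element of their maximum. *)
Definition bowen_ball T x n eps : set X :=
  [set y | \big[Order.max/0]_(0 <= j < n)
             mdist (iter j T x) (iter j T y) < eps].

(* A ball B_v(x, eps) is recorded as the pair (x, v): its weight depends on v,
   which the underlying set does not determine. *)
Definition bowen_covers T E n eps : set (set (X * nat)) :=
  [set C | [/\ countable C,
    forall p, C p -> (n <= p.2)%N &
    E `<=` \bigcup_(p in C) bowen_ball T p.1 p.2 eps]].

Definition bowen_content T E t n eps : \bar R :=
  ereal_inf [set (\esum_(p in C) (expR (- t * p.2%:R))%:E)%E
            | C in bowen_covers T E n eps].

Definition bowen_measure T E t eps : \bar R :=
  limn (fun n => bowen_content T E t n eps).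

Definition htop_at T E eps : \bar R :=
  ereal_inf [set t%:E | t in [set t : R | bowen_measure T E t eps = 0%E]].

Definition htop T E : \bar R := lim (htop_at T E eps @[eps --> 0^'+]).

End BowenEntropy.

(* Main.v *)
Require Import Defs.
From mathcomp Require Import all_boot all_order all_algebra.
From mathcomp Require Import all_classical all_reals all_analysis.
From mathcomp Require Import measurable_realfun.
From mathcomp Require Import zify ring lra.

Set Implicit Arguments.
Unset Strict Implicit.
Unset Printing Implicit Defensive.

Import Order.TTheory GRing.Theory Num.Theory.
Import numFieldNormedType.Exports.

Local Open Scope classical_set_scope.
Local Open Scope ring_scope.

(** The irregular set contains a family of points coded by all sequences over
a finite alphabet, rich enough to carry almost the entropy of [Y].

Fix [z] in [Y] and [s] below the entropy of [Y]. By compactness, every point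
of [Y] is joined to [z] and from [z] by [delta]-chains of length at most some
[M] that depends on [delta] only ([uniform_connection]). So any orbit segment
of a point of [Y] can be completed, at a cost of at most [2 * M] steps, into a
pseudo-orbit loop at [z] ([exists_loop]), and loops at [z] can be concatenated
in any order ([pseudo_orbit_concat]).

Two kinds of loops are used. The free loops follow the points of a large
[(n, eps0)]-separated subset of [Y]; such sets have at least about [expR (t *
n)] points for some [t > s] ([entropy_growth]), because a maximal one spans
[Y]. The tag loops follow a segment of length [m] with a high, respectively a
low, orbit sum of [Phi]. Averaging the orbit sum against an invariant measure
shows that sums at least as high as any number below [int Phi dmu_1], and as
low as any number above [int Phi dmu_2], occur at every length
([invariant_orbit_sum]). A block is a free loop with [n = K * m] followed by a
tag loop. When [K] is large the tags use a small share of the time, but that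
share is fixed, so that blocks with a high and with a low tag have averages on
two sides of a gap, once the free loops have been restricted by
the pigeonhole principle to a common length and nearly equal sums
([irregular_entropy_of_growth]).

The tag of the [j]-th block is prescribed, high or low according to the parity
of [trunc_log 2 j], and its free loop is arbitrary. The tag is thus constant
for times that double, which forbids convergence of the averages
([birkhoff_oscillation]): every point that shadows such a concatenation is
irregular. As for entropy, two such points in the same Bowen ball of order [v]
have the same free loops in all blocks that are completed before time [v].
A cover of the coded points by Bowen balls is therefore a cover of the
sequence space by cylinders, and such a cover obeys Kraft's inequality
([kraft_cover]). This bounds its Bowen sum away from zero
([coded_irregular_entropy]). *)

(** * Kraft's inequality for covers of a sequence space *)

(** Here [Q p] is the piece of the sequence space covered by [p], and a piece
lies in a cylinder of length [len p]. If the sum were less than 1, one could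
choose letters one at a time so that the pieces that meet the current cylinder,
of length [l], have total weight less than [#|A| ^- l]: the one-letter
extensions of the cylinder share these pieces. All these pieces have
[len p > l], so that the sequence obtained in the limit lies in none. *)
Lemma kraft_cover (R : realType) (A : finType) (P : choiceType) (C : set P)
    (Q : P -> (nat -> A) -> Prop) (len : P -> nat) :
    (0 < #|A|)%N ->
    (forall p w w', C p -> Q p w -> Q p w' ->
      forall i, (i < len p)%N -> w i = w' i) ->
    (forall w, exists2 p, C p & Q p w) ->
  (1 <= \esum_(p in C) ((#|A|%:R : R) ^- len p)%:E)%E.
Proof.
move=> A0 Qlen Qcover; rewrite leNgt; apply/negP => sum1.
set k : R := #|A|%:R.
have k0 : 0 < k by rewrite ltr0n.
pose f p : \bar R := (k ^- len p)%:E.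
have f0 p : (0 <= f p)%E by rewrite lee_fin invr_ge0 exprn_ge0// ltW.
pose compat (w : seq A) : set P :=
  [set p | exists2 u, Q p u & mkseq u (size w) = w].
pose rho w := (\esum_(p in C `&` compat w) f p)%E.
(* So all the points of a piece that meets [w] have the same letter after
   [w]. *)
have compat_len w p : (rho w < (k ^- size w)%:E)%E -> C p -> compat w p ->
    (size w < len p)%N.
  move=> rhow Cp wp; rewrite ltnNge; apply/negP => lenw.
  move: rhow; apply/negP; rewrite -leNgt.
  apply: (@le_trans _ _ (f p)).
    rewrite lee_fin lef_pV2 ?posrE ?exprn_gt0//.
    by rewrite ler_weXn2l// ler1n.
  apply: esum_ge; exists [set p]; last by rewrite fsbig_set1.
  by split; [exact: finite_set1|move=> _ ->].
have next w : (rho w < (k ^- size w)%:E)%E ->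
    exists a, (rho (rcons w a) < (k ^- (size w).+1)%:E)%E.
  move=> rhow; apply: contrapT => /forallNP nexta; move: (rhow).
  apply/negP; rewrite -leNgt.
  apply: (@le_trans _ _ (\sum_(a : A) rho (rcons w a))%E).
    apply: (@le_trans _ _ (\sum_(a : A) (k ^- (size w).+1)%:E)%E).
      rewrite sumEFin sumr_const lee_fin -mulr_natl -/k exprS invfM mulrA.
      by rewrite divff ?mul1r// gt_eqF.
    apply: lee_sum => a _; rewrite leNgt; apply/negP; exact: nexta.
  rewrite /rho.
  under eq_bigr do rewrite esum_mkcondr.
  rewrite -esum_sum; last by move=> p a _ _; case: ifP.
  rewrite esum_mkcondr; apply: le_esum => p Cp.
  have sub a : compat (rcons w a) p -> compat w p.
    move=> [u Qu]; rewrite size_rcons mkseqS => /rcons_inj[uw _].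
    by exists u.
  have at_ a u : compat (rcons w a) p -> Q p u -> u (size w) = a.
    move=> cwa Qu; have lw := compat_len _ _ rhow Cp (sub _ cwa).
    move: cwa => [u' Qu']; rewrite size_rcons mkseqS => /rcons_inj[_ <-].
    exact: Qlen Qu Qu' _ lw.
  case: ifPn => [/set_mem [u Qu _]|/negP nw]; last first.
    by rewrite big1// => a _; case: ifPn => // /set_mem /sub /mem_set.
  rewrite (bigD1 (u (size w)))//= big1 ?adde0; first by case: ifP.
  move=> a au; case: ifPn => // /set_mem /at_ /(_ Qu) ua.
  by rewrite ua eqxx in au.
have rho0 : (rho [::] < (k ^- 0)%:E)%E.
  rewrite expr0 invr1; apply: le_lt_trans sum1.
  rewrite /rho esum_mkcondr; apply: le_esum => p _.
  by case: ifP => // _; exact: f0.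
have [a0 _] : exists a : A, true by move/card_gt0P : A0 => [a _]; exists a.
have /choice[nx nxP] : forall w, exists a, (rho w < (k ^- size w)%:E)%E ->
    (rho (rcons w a) < (k ^- (size w).+1)%:E)%E.
  move=> w; have [/next[a ?]|] := pselect (rho w < (k ^- size w)%:E)%E.
    by exists a.
  by exists a0.
pose pre := fix pre n := if n is m.+1 then rcons (pre m) (nx (pre m)) else [::].
have size_pre n : size (pre n) = n.
  by elim: n => //= n IH; rewrite size_rcons IH.
have rho_pre n : (rho (pre n) < (k ^- size (pre n))%:E)%E.
  by elim: n => //= n IH; rewrite size_rcons; exact: nxP.
pose u n := nx (pre n).
have mku n : mkseq u n = pre n by elim: n => // n IH; rewrite mkseqS IH.
have [p Cp Qp] := Qcover u.
have := compat_len (pre (len p)) p (rho_pre _) Cp.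
rewrite size_pre ltnn => h; apply/notF/h.
by exists u => //; rewrite size_pre mku.
Qed.

(** * Divergence of time averages *)

(** If the averages converged to [c], the average over a window [p, q) would be
close to [c] as well, as long as the window fills a fixed proportion of the
time elapsed: this is what [q <= r * (q - p)] says. *)
Lemma birkhoff_oscillation (R : realType) (f : nat -> R) (g th : R) (r : nat) :
    0 < th ->
    (forall N, exists p q, [/\ (N <= p)%N, (p < q)%N, (q <= r * (q - p))%N &
      (g + th) * (q - p)%:R <= \sum_(p <= i < q) f i]) ->
    (forall N, exists p q, [/\ (N <= p)%N, (p < q)%N, (q <= r * (q - p))%N &
      \sum_(p <= i < q) f i <= (g - th) * (q - p)%:R]) ->
  ~ cvg ((n%:R^-1 * \sum_(0 <= i < n) f i) @[n --> \oo]).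
Proof.
move=> th0 hi lo /cvg_ex[c] /cvgrPdist_le cvgc.
have r0 : (0 < r)%N.
  by have [p [q [_ pq + _]]] := hi 0%N; case: (r) => //; lia.
have rR : 1 <= r%:R :> R by rewrite ler1n.
(* The sums up to [p] and up to [q] are each off by at most [eta * q], which
   is at most [th / 4 * (q - p)]. *)
pose eta := th / (4 * r%:R).
have eta0 : 0 < eta by rewrite divr_gt0// mulr_gt0// ltr0n.
have [N _ NP] := cvgc _ eta0.
have close n : (N < n)%N -> `|n%:R * c - \sum_(0 <= i < n) f i| <= eta * n%:R.
  move=> Nn; have n0 : 0 < n%:R :> R by rewrite ltr0n; lia.
  have := NP n (ltnW Nn); rewrite -(ler_pM2l n0) -{1}(gtr0_norm n0) -normrM.
  by rewrite mulrBr mulrA divff ?gt_eqF// mul1r (mulrC eta).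
have diff p q : (N < p)%N -> (p < q)%N -> (q <= r * (q - p))%N ->
    `|(q - p)%:R * c - \sum_(p <= i < q) f i| <= th / 2 * (q - p)%:R.
  move=> Np pq qr; have := close p Np; have := close q (ltn_trans Np pq).
  rewrite (big_cat_nat (leq0n p) (ltnW pq))/=.
  have qrR : q%:R <= r%:R * (q - p)%:R :> R by rewrite -natrM ler_nat.
  rewrite natrB in qrR *; last exact: ltnW.
  have pqR : p%:R < q%:R :> R by rewrite ltr_nat.
  have etar : eta * q%:R <= th / 4 * (q%:R - p%:R).
    rewrite (_ : th / 4 * _ = eta * (r%:R * (q%:R - p%:R))).
      by rewrite ler_pM2l.
    by rewrite /eta; field; rewrite gt_eqF//; lra.
  have etap : eta * p%:R <= eta * q%:R by rewrite ler_pM2l// ltW.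
  by rewrite !ler_norml => /andP[? ?] /andP[? ?]; apply/andP; split; lra.
have [p [q [Np pq qr hi']]] := hi N.+1.
have [p' [q' [Np' pq' qr' lo']]] := lo N.+1.
have := diff _ _ Np pq qr; have := diff _ _ Np' pq' qr'.
rewrite !ler_norml => /andP[d1 d2] /andP[d3 d4].
have q0 : 0 < (q - p)%:R :> R by rewrite ltr0n subn_gt0.
have q0' : 0 < (q' - p')%:R :> R by rewrite ltr0n subn_gt0.
have hc : g + th / 2 <= c.
  by rewrite -(ler_pM2r q0); lra.
have lc : c <= g - th / 2.
  by rewrite -(ler_pM2r q0'); lra.
lra.
Qed.

(** * Pseudo-orbits and chain recurrent classes *)

Section Chains.
Context {R : realType} {X : metricType R}.
Implicit Types (T : X -> X) (x y z : X) (delta eta : R) (u v w : nat -> X).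

(** The word [u] and its length [k] are explicit because words are concatenated
and their lengths counted. *)
Definition chain_path T delta (k : nat) u x y :=
  [/\ u 0%N = x, u k = y &
    forall i, (i < k)%N -> mdist (T (u i)) (u i.+1) < delta].

Definition cat_path u k v (i : nat) : X :=
  if (i < k)%N then u i else v (i - k)%N.

Lemma chain_path_cat T delta k u l v x y z :
  chain_path T delta k u x y -> chain_path T delta l v y z ->
  chain_path T delta (k + l)%N (cat_path u k v) x z.
Proof.
move=> [u0 uk uP] [v0 vl vP]; split.
- by rewrite /cat_path; case: k uk {uP} => [|k] uk //=; rewrite v0 -uk.
- by rewrite /cat_path ltnNge leq_addr /= addKn.
- move=> i ikl; rewrite /cat_path; case: ltnP => ik.
    case: ltnP => ik'; first exact: uP.
    have ki : k = i.+1 by lia.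
    by rewrite -ki subnn v0 -uk ki; apply: uP; rewrite ki.
  rewrite ltnNge (leq_trans ik)//= subSn//; apply: vP; lia.
Qed.

Lemma chain_pathP T delta x y :
  chain T delta x y <->
  exists2 k, (1 <= k)%N & exists u, chain_path T delta k u x y.
Proof.
split; first by move=> [k [u [k1 ? ? ?]]]; exists k => //; exists u.
by move=> [k k1 [u [? ? ?]]]; exists k, u.
Qed.

Lemma orbit_path T delta n x : 0 < delta ->
  chain_path T delta n (fun i => iter i T x) x (iter n T x).
Proof. by move=> d0; split => // i _; rewrite iterS mdistxx. Qed.

Lemma chain_trans T delta x y z :
  chain T delta x y -> chain T delta y z -> chain T delta x z.
Proof.
move=> /chain_pathP[k k1 [u uP]] /chain_pathP[l l1 [v vP]].
apply/chain_pathP; exists (k + l)%N; first by rewrite addn_gt0 k1.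
by exists (cat_path u k v); exact: chain_path_cat uP vP.
Qed.

(** Moving an end point of a chain affects a single jump. This makes the class
closed, and makes the chains to finitely many points serve for all. *)
Lemma chain_path_move_end T delta eta k u x y y' : (1 <= k)%N ->
  chain_path T delta k u x y -> mdist y y' < eta ->
  exists v, chain_path T (delta + eta) k v x y'.
Proof.
move=> k1 [u0 uk uP] yy'.
exists (fun i => if i == k then y' else u i); split.
- by rewrite ltn_eqF.
- by rewrite eqxx.
- move=> i ik; rewrite (ltn_eqF ik); case: eqP => [ik1|_].
    apply: le_lt_trans (metric_triangle _ y _) _.
    by rewrite ltrD// -uk -ik1 uP.
  apply: lt_le_trans (uP _ ik) _.
  by rewrite lerDl (le_trans _ (ltW yy'))// mdist_ge0.
Qed.

Lemma chain_path_move_start T delta eta k u x x' y : (1 <= k)%N ->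
  chain_path T delta k u x y -> mdist (T x') (T x) < eta ->
  exists v, chain_path T (delta + eta) k v x' y.
Proof.
move=> k1 [u0 uk uP] xx'.
exists (fun i => if i == 0%N then x' else u i); split => //.
- by rewrite gtn_eqF.
- move=> i ik; rewrite /=; case: eqP => [i0|_].
    apply: le_lt_trans (metric_triangle _ (T x) _) _.
    by rewrite addrC ltrD// -u0 -i0 uP.
  apply: lt_le_trans (uP _ ik) _.
  by rewrite lerDl (le_trans _ (ltW xx'))// mdist_ge0.
Qed.

(** The blocks have varying lengths, so the position at time [n] is computed by
iterating a step function on pairs (block, index in the block). *)
Lemma pseudo_orbit_concat T delta (W : nat -> nat -> X) (len : nat -> nat) z :
  (forall j, (0 < len j)%N) ->
  (forall j, chain_path T delta (len j) (W j) z z) ->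
  exists2 u, pseudo_orbit T delta u &
    forall j i, (i < len j)%N -> u (\sum_(l < j) len l + i)%N = W j i.
Proof.
move=> len0 Wpath.
pose step (s : nat * nat) :=
  if (s.2.+1 < len s.1)%N then (s.1, s.2.+1) else (s.1.+1, 0%N).
pose st n := iter n step (0%N, 0%N).
have st_lt n : ((st n).2 < len (st n).1)%N.
  elim: n => [|n IH]; first exact: len0.
  by rewrite /st iterS -/(st n) /step; case: ifP.
have st_off j n i : st n = (j, 0%N) -> (i < len j)%N -> st (n + i)%N = (j, i).
  move=> stn; elim: i => [|i IH] ilen; first by rewrite addn0.
  by rewrite addnS /st iterS -/(st _) IH ?(ltnW ilen)// /step /= ilen.
have st_pos j : st (\sum_(l < j) len l)%N = (j, 0%N).
  elim: j => [|j IH]; first by rewrite big_ord0.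
  rewrite big_ord_recr/= -[len j](prednK (len0 j)) addnS /st iterS -/(st _).
  by rewrite (st_off j)// ?prednK// /step /= prednK// ltnn.
exists (fun n => W (st n).1 (st n).2); last first.
  by move=> j i ij; rewrite (st_off j).
move=> n; have [W0 Wl Ws] := Wpath (st n).1.
rewrite (_ : st n.+1 = step (st n))// /step; case: ltnP => /= [h|h].
  by apply: Ws; exact: st_lt.
have e : (st n).2.+1 = len (st n).1 by apply/eqP; rewrite eqn_leq h st_lt.
have [-> _ _] := Wpath (st n).1.+1.
by rewrite -Wl -e; apply: Ws; exact: st_lt.
Qed.

(** A point chain related to [z] is chain recurrent, through [z]; so membership
in the class is a single condition. *)
Lemma chain_recurrent_classE T Y : chain_recurrent_class T Y ->
  exists2 z, Y z & Y = [set y | chain_related T z y].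
Proof.
move=> [z zz YE]; exists z; first by rewrite YE; split.
rewrite YE; apply/seteqP; split=> [y [] //|y zy]; split => // e e0.
by have [c1 c2] := zy e e0; split; exact: chain_trans c2 c1.
Qed.

Lemma metric_nbhsP x (P : set X) :
  (\forall y \near x, P y) <->
  exists2 r : R, 0 < r & forall y, mdist x y < r -> P y.
Proof.
by rewrite /prop_near1 -metricType_numDomainType.filter_from_mdist_nbhs.
Qed.

Lemma continuous_modulus_at T x eta : continuous T -> 0 < eta ->
  exists2 r : R, 0 < r & forall y, mdist x y < r -> mdist (T x) (T y) < eta.
Proof.
move=> cT eta0.
have /metricType_numDomainType.cvgrPdist_lt/(_ _ eta0) := cT x.
by move/metric_nbhsP.
Qed.

(** A chain from [y] to [z] whose first jump is removed nearly starts at [T y].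
It is first prolonged by a chain from [z] to [z], so that a jump remains. *)
Lemma chain_class_invariant T z : continuous T ->
  chain_recurrent T z ->
  forall y, chain_related T z y -> chain_related T z (T y).
Proof.
move=> cT zz y zy e e0; split.
  apply: chain_trans (zy e e0).1 _.
  apply/chain_pathP; exists 1%N => //; exists (fun i => iter i T y).
  exact: (orbit_path _ 1).
have e2 : 0 < e / 2 by rewrite divr_gt0.
have [r r0 rP] := continuous_modulus_at (T y) cT e2.
pose d := Num.min r (e / 2).
have d0 : 0 < d by rewrite lt_min r0.
have /chain_pathP[k k1 [u uP]] := (zy d d0).2.
have /chain_pathP[l l1 [v vP]] := (zz d d0).1.
have [w0 wk wP] := chain_path_cat uP vP.
set w := cat_path u k v in w0 wk wP.
have Ty1 : mdist (T y) (w 1%N) < d by rewrite -w0; apply: wP; lia.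
have kl : ((k + l).-1.+1 = k + l)%N by lia.
apply/chain_pathP; exists (k + l).-1; first by lia.
exists (fun i => if i == 0%N then T y else w i.+1); split => //.
  by rewrite gtn_eqF ?kl//; lia.
move=> i ikl; case: i ikl => [|i] ikl /=.
  apply: le_lt_trans (metric_triangle _ (T (w 1%N)) _) _.
  rewrite (splitr e) ltrD//.
    by apply: rP; rewrite /= (lt_le_trans Ty1)// ge_min lexx.
  by apply: lt_le_trans (wP 1%N _) _; [lia|rewrite ge_min lexx orbT].
apply: lt_le_trans (wP _ _) _; first by lia.
by rewrite ge_min ler_pdivrMr// ler_peMr ?orbT// ?ler1n// ltW.
Qed.
End Chains.

(** * Loops at a point of a chain recurrent class *)

Section Returns.
Context {R : realType} {X : metricType R}.
Implicit Types (T : X -> X) (x y z : X) (delta eta : R) (u v w : nat -> X).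

Lemma chain_class_closed T z : continuous T ->
  closed [set y | chain_related T z y].
Proof.
move=> cT y yY e e0.
have e2 : 0 < e / 2 by rewrite divr_gt0.
have [r r0 rP] := continuous_modulus_at y cT e2.
have m0 : 0 < Num.min r (e / 2) by rewrite lt_min r0.
have /yY [y' [zy' yy']] : nbhs y [set y' | mdist y y' < Num.min r (e / 2)].
  by apply/metric_nbhsP; exists (Num.min r (e / 2)).
have {yy'}[yr ye] : mdist y y' < r /\ mdist y y' < e / 2.
  by split; apply: lt_le_trans yy' _; rewrite ge_min lexx ?orbT.
have [/chain_pathP[k k1 [u uP]] /chain_pathP[l l1 [v vP]]] := zy' _ e2.
rewrite (splitr e); split; apply/chain_pathP.
  exists k => //; apply: (chain_path_move_end k1 uP).
  by rewrite metric_sym.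
by exists l => //; exact: (chain_path_move_start l1 vP (rP _ yr)).
Qed.

(** Near each point of [X], all points of the class can use the chains of one
of them, with an end point moved; compactness makes the bound uniform. *)
Lemma uniform_connection T z delta : compact [set: X] -> continuous T ->
    0 < delta ->
  exists M, forall y, chain_related T z y ->
    (exists2 k, (1 <= k <= M)%N & exists u, chain_path T delta k u z y) /\
    (exists2 k, (1 <= k <= M)%N & exists u, chain_path T delta k u y z).
Proof.
move=> cX cT d0.
pose good (M : nat) y := chain_related T z y ->
    (exists2 k, (1 <= k <= M)%N & exists u, chain_path T delta k u z y) /\
    (exists2 k, (1 <= k <= M)%N & exists u, chain_path T delta k u y z).
suff [N _ /(_ N (leqnn _)) NP] : \forall M \near \oo, [set: X] `<=` good M.
  by exists N => y; exact: NP.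
move/compact_near_coveringP : cX; apply => x _.
have d2 : 0 < delta / 2 by rewrite divr_gt0.
have d4 : 0 < delta / 4 by rewrite divr_gt0.
have [r r0 rP] := continuous_modulus_at x cT d4.
pose s := Num.min r (delta / 4).
have s0 : 0 < s by rewrite lt_min r0.
have bx : \forall y \near x, mdist x y < s by apply/metric_nbhsP; exists s.
have [[y0 [y0z xy0]]|noy] :=
    pselect (exists y0, chain_related T z y0 /\ mdist x y0 < s); last first.
  exists ([set y | mdist x y < s], setT) => /=.
    by split => //; exact: filterT.
  by move=> [y M] /= [xy _] zy; exfalso; apply: noy; exists y.
have [/chain_pathP[k k1 [u uP]] /chain_pathP[l l1 [v vP]]] := y0z _ d2.
exists ([set y | mdist x y < s], [set M | (maxn k l <= M)%N]) => /=.
  by split => //; exists (maxn k l).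
move=> [y M] /= [xy]; rewrite geq_max => /andP[kM lM] zy.
move: xy0 xy; rewrite !lt_min => /andP[xr0 xd0] /andP[xr xd].
rewrite (splitr delta); split.
  exists k; first by rewrite k1.
  apply: (chain_path_move_end k1 uP).
  by apply: le_lt_trans (metric_triangle _ x _) _; rewrite (metric_sym y0); lra.
exists l; first by rewrite l1.
apply: (chain_path_move_start l1 vP).
apply: le_lt_trans (metric_triangle _ (T x) _) _.
by have := rP _ xr; have := rP _ xr0; rewrite (metric_sym (T y)); lra.
Qed.

(** A loop [w] at [z], of length [N], that contains the first [n] iterates of
[y] from its index [a] on. *)
Definition loop_through T delta z (n a N : nat) w y :=
  [/\ chain_path T delta N w z z, (a + n <= N)%N &
    forall i, (i < n)%N -> w (a + i)%N = iter i T y].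

Lemma exists_loop T z delta : compact [set: X] -> continuous T ->
    0 < delta -> chain_recurrent T z ->
  exists M, forall y n, chain_related T z y ->
    exists a N w, [/\ loop_through T delta z n a N w y, (a <= M)%N,
      (0 < N)%N & (N <= n + 2 * M)%N].
Proof.
move=> cX cT d0 zz; have [M MP] := uniform_connection z cX cT d0.
exists M => y n zy.
have zTy : chain_related T z (iter n T y).
  by elim: n => //= n IH; exact: chain_class_invariant.
have [[k /andP[k1 kM] [u uP]] _] := MP _ zy.
have [_ [l /andP[l1 lM] [v vP]]] := MP _ zTy.
have cP := chain_path_cat (chain_path_cat uP (orbit_path _ n y d0)) vP.
exists k, (k + n + l)%N,
  (cat_path (cat_path u k (fun i => iter i T y)) (k + n) v).
split; [split => //| | |]; try lia.
move=> i ilt; rewrite /cat_path ltn_add2l ilt ltnNge leq_addr /=.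
by rewrite addKn.
Qed.

Lemma uniform_modulus (Phi : X -> R) eta : compact [set: X] -> continuous Phi ->
    0 < eta ->
  exists2 r : R, 0 < r & forall x y, mdist x y < r -> `|Phi x - Phi y| < eta.
Proof.
move=> cX cPhi eta0.
pose good (r : R) x := forall y, mdist x y < r -> `|Phi x - Phi y| < eta.
suff : \forall r \near 0^'+, [set: X] `<=` good r.
  move=> H; near (0:R)^'+ => r; exists r => // x.
  have : [set: X] `<=` good r by near: r; exact: H.
  by move=> /(_ x I).
move/compact_near_coveringP : cX; apply => x _.
have e2 : 0 < eta / 2 by rewrite divr_gt0.
have /cvgrPdist_lt/(_ _ e2)/metric_nbhsP[r r0 rP] := cPhi x.
have r2 : 0 < r / 2 by rewrite divr_gt0.
exists ([set y | mdist x y < r / 2], [set s | s < r / 2]) => /=.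
  split; first by apply/metric_nbhsP; exists (r / 2).
  exact: nbhs_right_lt.
move=> [x' s] /= [xx' sr] y x'y.
have x1 := rP x' (lt_le_trans xx' _).
have x2 : `|Phi x - Phi y| < eta / 2.
  apply: rP; apply: le_lt_trans (metric_triangle _ x' _) _; lra.
have {}x1 : `|Phi x - Phi x'| < eta / 2 by apply: x1; lra.
rewrite (_ : Phi x' - Phi y = (Phi x - Phi y) - (Phi x - Phi x')); last by ring.
by apply: le_lt_trans (ler_normB _ _) _; lra.
Unshelve. all: by end_near. Qed.

Lemma compact_bounded_fun (Phi : X -> R) : compact [set: X] -> continuous Phi ->
  exists2 C : R, 0 < C & forall x, `|Phi x| <= C.
Proof.
move=> cX cPhi.
have /compact_bounded[C [_ CP]] : compact (Phi @` [set: X]).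
  by apply: continuous_compact => //; exact: continuous_subspaceT.
exists (`|C| + 1); first by rewrite ltr_wpDl.
move=> x; apply: (CP (`|C| + 1)); last by exists x.
by rewrite ltr_pwDr// ler_norm.
Qed.

End Returns.

(** * Bowen entropy *)

Lemma ereal_between (R : realType) (x y : \bar R) : (x < y)%E ->
  exists2 t : R, (x < t%:E)%E & (t%:E < y)%E.
Proof.
case: x y => [x| |] [y| |]//=; rewrite ?lte_fin => xy.
- by exists ((x + y) / 2); rewrite lte_fin; lra.
- by exists (x + 1); rewrite ?ltry// lte_fin ltrDl.
- by exists (y - 1); rewrite ?ltNyr// lte_fin gtrBl.
- by exists 0; rewrite ?ltNyr ?ltry.
Qed.

Section Entropy.
Context {R : realType} {X : metricType R}.
Implicit Types (T : X -> X) (x : X) (E : set X) (eps s t : R) (n : nat).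

Lemma bowen_ballP T x n eps y : 0 < eps ->
  bowen_ball T x n eps y <->
  forall j, (j < n)%N -> mdist (iter j T x) (iter j T y) < eps.
Proof.
move=> e0; rewrite /bowen_ball /= big_mkord; split.
  by move/bigmax_ltP => [_ h] j jn; exact: (h (Ordinal jn) isT).
by move=> h; apply/bigmax_ltP; split => // i _; exact: h.
Qed.

Lemma bowen_content_ge0 T E t n eps : (0 <= bowen_content T E t n eps)%E.
Proof.
apply: le_ereal_inf_tmp => _ [C _ <-]; apply: esum_ge0 => p _.
by rewrite lee_fin expR_ge0.
Qed.

Lemma bowen_content_le T E t eps m n : (m <= n)%N ->
  (bowen_content T E t m eps <= bowen_content T E t n eps)%E.
Proof.
move=> mn; apply: ereal_inf_le_tmp => _ [C [cC Cn CE] <-]; exists C => //.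
by split => // p /Cn; exact: leq_trans.
Qed.

Lemma bowen_measureE T E t eps :
  bowen_measure T E t eps =
  ereal_sup (range (fun n => bowen_content T E t n eps)).
Proof.
apply/cvg_lim => //; apply: ereal_nondecreasing_cvgn => m n mn.
exact: bowen_content_le.
Qed.

Lemma bowen_content_le_eps T E t n eps eps' : eps <= eps' ->
  (bowen_content T E t n eps' <= bowen_content T E t n eps)%E.
Proof.
move=> ee; apply: ereal_inf_le_tmp => _ [C [cC Cn CE] <-]; exists C => //.
split => // x /CE [p Cp px]; exists p => //.
exact: lt_le_trans px ee.
Qed.

Lemma htop_at_le_eps T E eps eps' : eps <= eps' ->
  (htop_at T E eps' <= htop_at T E eps)%E.
Proof.
move=> ee; apply: ereal_inf_le_tmp => _ [t /= t0 <-]; exists t => //=.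
apply/eqP; rewrite eq_le; apply/andP; split.
  rewrite -t0 !bowen_measureE; apply: ge_ereal_sup => _ [n _ <-].
  by apply: le_ereal_sup_tmp; exists (bowen_content T E t n eps);
    [exists n|exact: bowen_content_le_eps].
rewrite bowen_measureE; apply: le_ereal_sup_tmp.
by exists (bowen_content T E t 0 eps'); [exists 0%N|exact: bowen_content_ge0].
Qed.

(** Entropy at scale [eps] grows as [eps] decreases, so its limit is a
supremum. *)
Lemma htopE T E :
  htop T E = ereal_sup [set htop_at T E eps | eps in [set eps : R | 0 < eps]].
Proof.
apply/cvg_lim => //.
have := @nonincreasing_at_right_cvge R (htop_at T E) 0 +oo%O isT.
rewrite (_ : [set` `]0, +oo[] = [set eps : R | 0 < eps]); last first.
  by apply/seteqP; split=> x /=; rewrite in_itv/= andbT.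
by apply=> x y _ _ xy; exact: htop_at_le_eps.
Qed.

Lemma htop_at_ge T E s eps :
    (forall t, t < s -> exists n, (0 < bowen_content T E t n eps)%E) ->
  (s%:E <= htop_at T E eps)%E.
Proof.
move=> h; apply: le_ereal_inf_tmp => _ [t /= t0 <-].
rewrite lee_fin leNgt; apply/negP => /h [n]; apply/negP; rewrite -leNgt -t0.
by rewrite bowen_measureE; apply: ereal_sup_ubound; exists n.
Qed.

Lemma htop_at_gt T E t eps : (t%:E < htop_at T E eps)%E ->
  exists2 c : R, 0 < c & exists n0, forall n, (n0 <= n)%N ->
    (c%:E <= bowen_content T E t n eps)%E.
Proof.
move=> tE.
have : (0 < bowen_measure T E t eps)%E.
  rewrite lt_neqAle bowen_measureE; apply/andP; split.
    apply/eqP => m0; move: tE; apply/negP; rewrite -leNgt.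
    by apply: ereal_inf_lbound; exists t => //=; rewrite bowen_measureE.
  apply: le_ereal_sup_tmp; exists (bowen_content T E t 0 eps).
    by exists 0%N.
  exact: bowen_content_ge0.
rewrite bowen_measureE => /ereal_sup_gt[_ [n0 _ <-]] /ereal_between[c c0 cn].
exists c => //; exists n0 => n nn; apply: (le_trans (ltW cn)).
exact: bowen_content_le.
Qed.

Definition bowen_separated T n eps (I : Type) (y : I -> X) :=
  forall i j, i <> j -> exists2 l, (l < n)%N &
    eps <= mdist (iter l T (y i)) (iter l T (y j)).

Lemma bowen_content_spanning T E t n eps k (y : 'I_k -> X) : injective y ->
    E `<=` \bigcup_i bowen_ball T (y i) n eps ->
  (bowen_content T E t n eps <= (k%:R * expR (- t * n%:R))%:E)%E.
Proof.
move=> yinj Ey; apply: ge_ereal_inf.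
pose C := (fun i => (y i, n)) @` [set: 'I_k].
exists (\esum_(p in C) (expR (- t * p.2%:R))%:E)%E.
  exists C => //; split.
  - by apply: finite_set_countable; apply: finite_image.
  - by move=> _ [i _ <-].
  - by move=> x /Ey [i _ ix]; exists (y i, n) => //; exists i.
rewrite esum_image; last by move=> i j _ _ [] /yinj.
rewrite esum_fset; last 2 first.
  exact: finite_finset.
  by move=> i _; rewrite lee_fin expR_ge0.
rewrite (_ : (\sum_(_ \in _) _)%E = (\sum_(i : 'I_k) (expR (- t * n%:R))%:E)%E).
  by rewrite sumEFin sumr_const card_ord lee_fin mulr_natl.
rewrite (_ : [set: 'I_k] = [set` index_enum 'I_k]); last first.
  by apply/seteqP; split => i //= _; exact: mem_index_enum.
by rewrite -fsbig_seq// index_enum_uniq.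
Qed.

(** A separated family that does not span [E] can be enlarged, and a spanning
one has at least [c * expR (t * n)] elements. *)
Lemma separated_family T E t n eps (c : R) : 0 < eps -> 0 < c ->
    (c%:E <= bowen_content T E t n eps)%E ->
  exists k (y : 'I_k -> X), [/\ forall i, E (y i),
    bowen_separated T n eps y & c * expR (t * n%:R) <= k%:R].
Proof.
move=> e0 c0 cE.
have grow k : (exists y : 'I_k -> X,
      (forall i, E (y i)) /\ bowen_separated T n eps y) ->
    k%:R < c * expR (t * n%:R) ->
    exists y : 'I_k.+1 -> X, (forall i, E (y i)) /\ bowen_separated T n eps y.
  move=> [y [yE ysep]] kc.
  have yinj : injective y.
    move=> i j yij; apply: contrapT => /ysep[l _].
    by rewrite yij mdistxx leNgt e0.
  have : ~ E `<=` \bigcup_i bowen_ball T (y i) n eps.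
    move=> /(bowen_content_spanning t yinj); apply/negP; rewrite -ltNge.
    apply: lt_le_trans cE; rewrite lte_fin mulNr expRN.
    by rewrite ltr_pdivrMr// expR_gt0.
  move=> /existsNP[x /not_implyP[Ex xy]].
  have far i : exists2 l, (l < n)%N &
      eps <= mdist (iter l T (y i)) (iter l T x).
    apply: contrapT => h; apply: xy; exists i => //.
    apply/bowen_ballP => // j jn; rewrite ltNge; apply/negP => hj.
    by apply: h; exists j.
  exists (fun i => if unlift ord0 i is Some j then y j else x); split.
    by move=> i; case: unliftP.
  move=> i j; case: unliftP => [i' ->|->]; case: unliftP => [j' ->|->] //.
  - by move=> ij; apply: ysep => ij'; apply: ij; rewrite ij'.
  - by move=> _; have [l ln lx] := far j'; exists l; rewrite // metric_sym.
set v := c * _ in grow *.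
have v0 : 0 < v by rewrite mulr_gt0 ?expR_gt0.
have fam k : k%:R < v + 1 -> exists y : 'I_k -> X,
    (forall i, E (y i)) /\ bowen_separated T n eps y.
  elim: k => [_|k IH kv].
    have no (i : 'I_0) : False by case: i.
    by exists (fun i => False_rect X (no i)); split=> i; case: (no i).
  rewrite -natr1 ltrD2r in kv; apply: grow => //; apply: IH.
  by rewrite ltr_wpDr.
have [k vk kv] : exists2 k, v <= k%:R & k%:R < v + 1.
  have /andP[tv vt] := Num.Theory.truncn_itv (ltW v0).
  have [vle|] := leP v (Num.truncn v)%:R.
    by exists (Num.truncn v) => //; rewrite (le_lt_trans tv)// ltrDl.
  by exists (Num.truncn v).+1; [exact: ltW|rewrite -natr1 ltrD2r].
by have [y [yE ysep]] := fam k kv; exists k, y.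
Qed.
End Entropy.

(** * Orbit sums and invariant measures *)

Section InvariantMeasures.
Context {R : realType} {X : pointedMetricType R}.
Implicit Types (T : X -> X) (mu : probability (borelType X) R) (Y : set X)
  (Phi : X -> R).

Lemma borel_open (U : set X) : open U -> measurable (U : set (borelType X)).
Proof. by move=> oU; exact: sub_sigma_algebra. Qed.

Lemma borel_closed (F : set X) : closed F -> measurable (F : set (borelType X)).
Proof.
move=> cF; rewrite -(setCK F); apply: measurableC.
by apply: borel_open; exact: closed_openC.
Qed.

Lemma continuous_borel_map T : continuous T ->
  measurable_fun [set: borelType X] (T : borelType X -> borelType X).
Proof.
move=> /continuousP cT.
apply: (measurability (@open X : set (set (borelType X)))) => //.
move=> _ [U oU <-]; rewrite setTI; apply: borel_open; exact: cT.
Qed.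

Lemma continuous_borel_fun Phi : continuous Phi ->
  measurable_fun [set: borelType X] (Phi : borelType X -> R).
Proof.
move=> /continuousP cPhi; apply: (measurability _ (RGenOpens.measurableE R)).
move=> _ [_ [a [b ->] <-]]; rewrite setTI; apply: borel_open.
exact/cPhi/interval_open.
Qed.

Lemma continuous_borel_integrable mu Phi : compact [set: X] -> continuous Phi ->
  mu.-integrable [set: borelType X] (EFin \o (Phi : borelType X -> R)).
Proof.
move=> cX cPhi; apply: measurable_bounded_integrable => //.
- by apply: le_lt_trans (probability_le1 mu measurableT) _; rewrite ltry.
- exact: continuous_borel_fun.
- have [C C0 CP] := compact_bounded_fun cX cPhi.
  exists C; split; first exact: num_real.
  by move=> x Cx y _; apply: le_trans (CP _) (ltW Cx).
Qed.

Lemma invariant_integral T mu Phi : compact [set: X] -> continuous T ->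
    continuous Phi -> invariant_measure T mu ->
  (\int[mu]_x (Phi (T x))%:E = \int[mu]_x (Phi x)%:E)%E.
Proof.
move=> cX cT cPhi inv.
have mT := continuous_borel_map cT.
have cPT : continuous (Phi \o T).
  by move=> x; exact: continuous_comp (cT x) (cPhi _).
transitivity
  (\int[pushforward mu (T : borelType X -> borelType X)]_x (Phi x)%:E)%E;
  last first.
  by apply: eq_measure_integral => A mA _; exact: inv.
rewrite (integral_pushforward mT) //.
- by apply/measurable_EFinP; exact: (continuous_borel_fun cPhi).
- rewrite preimage_setT; exact: (continuous_borel_integrable mu cX cPT).
Qed.

(** By invariance, the orbit sum of length [m] has integral [m] times that of
[Phi], so it cannot be less than [c * m] on a set of full measure. That set has
to be measurable, hence the assumption that [Y] is closed. *)
Lemma invariant_orbit_sum T mu Phi Y (c : R) (m : nat) :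
    compact [set: X] -> continuous T -> continuous Phi ->
    invariant_measure T mu -> closed Y -> mu Y = 1%E ->
    (c%:E < \int[mu]_x (Phi x)%:E)%E -> (0 < m)%N ->
  exists2 y, Y y & c * m%:R <= \sum_(0 <= i < m) Phi (iter i T y).
Proof.
move=> cX cT cPhi inv clY muY cint m0.
have cI i : continuous (fun x => Phi (iter i T x)).
  move=> x; apply: (@continuous_comp _ _ _ (iter i T) Phi); last exact: cPhi.
  elim: i x => [|i IH] x; first exact: cvg_id.
  exact: (@continuous_comp _ _ _ (iter i T) T x (IH x) (cT _)).
have intI i : (\int[mu]_x (Phi (iter i T x))%:E = \int[mu]_x (Phi x)%:E)%E.
  elim: i => // i IH; rewrite -IH -(invariant_integral cX cT (cI i) inv).
  by apply: eq_integral => x _; rewrite iterSr.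
have mY : measurable (Y : set (borelType X)) by exact: borel_closed.
have muYC : mu (~` Y) = 0%E.
  by rewrite probability_setC// muY subee.
have mYC : measurable (~` Y : set (borelType X)) by exact: measurableC.
have onY Psi : continuous Psi ->
    (\int[mu]_x (Psi x)%:E = \int[mu]_(x in Y) (Psi x)%:E)%E.
  move=> cPsi; rewrite (negligible_integral mYC) //.
    by rewrite setTD setCK.
  exact: continuous_borel_integrable.
apply: contrapT => noy; move: (cint); apply/negP; rewrite -leNgt.
have fin : (\int[mu]_x (Phi x)%:E)%E \is a fin_num.
  by apply: integrable_fin_num => //; exact: continuous_borel_integrable.
have iY i : mu.-integrable Y (EFin \o (fun x => Phi (iter i T x))).
  by apply: integrableS (continuous_borel_integrable mu cX (cI i)).
have : (\int[mu]_(x in Y) (\sum_(0 <= i < m) (Phi (iter i T x))%:E)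
    <= \int[mu]_(x in Y) (c * m%:R)%:E)%E.
  apply: le_integral => //.
  - by apply: integrable_sum => // i _; exact: iY.
  - apply: integrableS (continuous_borel_integrable mu cX _) => //.
    by move=> x; exact: cvg_cst.
  - move=> x /set_mem Yx; rewrite sumEFin lee_fin leNgt; apply/negP => h.
    by apply: noy; exists x => //; exact: ltW.
rewrite integral_cst// [X in (_ * X)%E](_ : _ = 1%E)// mule1 integral_sum//.
under eq_bigr do rewrite -onY// intI.
rewrite -(fineK fin) sumEFin !lee_fin sumr_const_nat subn0.
by rewrite -[X in X <= _]mulr_natr ler_pM2r// ltr0n.
Qed.

End InvariantMeasures.

(** * Entropy of a set of coded irregular points *)

Lemma le_esumZ (R : realType) (P : choiceType) (C : set P) (a : P -> \bar R)
    (c : R) : 0 <= c -> (forall p, 0 <= a p)%E ->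
  (\esum_(p in C) (c%:E * a p) <= c%:E * \esum_(p in C) a p)%E.
Proof.
move=> c0 a0; apply: ge_ereal_sup => _ [F [finF FC] <-].
rewrite -ge0_mule_fsumr//; apply: lee_wpmul2l; first by rewrite lee_fin.
by apply: ereal_sup_ubound; exists F.
Qed.

Lemma sum_consecutive_ge (R : realType) (f : nat -> R) (c : R)
    (P : nat -> nat) (j k : nat) : {homo P : a b / (a <= b)%N} -> (j <= k)%N ->
    (forall l, (j <= l < k)%N ->
      c * (P l.+1 - P l)%:R <= \sum_(P l <= i < P l.+1) f i) ->
  c * (P k - P j)%:R <= \sum_(P j <= i < P k) f i.
Proof.
move=> Pmono; elim: k => [|k IH] jk blk.
  have -> : j = 0%N by lia.
  by rewrite subnn mulr0 big_geq.
have [jk'|->] : (j <= k)%N \/ j = k.+1 by lia.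
  rewrite (big_cat_nat (Pmono _ _ jk') (Pmono _ _ (leqnSn k)))/=.
  rewrite (_ : (P k.+1 - P j = (P k - P j) + (P k.+1 - P k))%N); last first.
    by have := Pmono _ _ jk'; have := Pmono _ _ (leqnSn k); lia.
  rewrite natrD mulrDr lerD//; last by apply: blk; lia.
  by apply: IH => // l lk; apply: blk; lia.
by rewrite subnn mulr0 big_geq.
Qed.

Section Coding.
Context {R : realType} {X : metricType R}.
Implicit Types (T : X -> X) (x y z : X).

(** The words [W true a] have averages of [Phi] above [g + 2 * th], and the
words [W false a] below [g - 2 * th]. Half of the margin is lost when a word is
replaced with a point that shadows it. A point coded by [w : nat -> A] follows
[W (ty j) (w j)] during the [j]-th block. Since [ty] does not depend on [w],
all coded points have the same block times [pos j], which makes their orbits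
comparable. *)
Lemma coded_irregular_entropy T (Phi : X -> R) (A : finType)
    (W : bool -> A -> nat -> X) (len : bool -> nat) z
    (delta eps s g th : R) (L : nat) :
    0 < eps -> 0 < th -> 0 <= s -> (0 < #|A|)%N ->
    (forall u, pseudo_orbit T delta u ->
      exists y, forall n, mdist (iter n T y) (u n) < eps) ->
    (forall x y, mdist x y < eps -> `|Phi x - Phi y| < th) ->
    (forall b a, chain_path T delta (len b) (W b a) z z) ->
    (forall b, (0 < len b <= L)%N) ->
    (forall b a a', a <> a' -> exists2 i, (i < len b)%N &
      4 * eps <= mdist (W b a i) (W b a' i)) ->
    (forall a, (g + 2 * th) * (len true)%:R <=
      \sum_(0 <= i < len true) Phi (W true a i)) ->
    (forall a, \sum_(0 <= i < len false) Phi (W false a i) <=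
      (g - 2 * th) * (len false)%:R) ->
    expR (s * L%:R) <= #|A|%:R ->
  (s%:E <= htop_at T (irregular_set T Phi) eps)%E.
Proof.
move=> e0 th0 s0 A0 shad modPhi Wpath lenL Wsep hi lo cardA.
pose ty j := odd (trunc_log 2 j).
pose pos j := (\sum_(l < j) len (ty l))%N.
have L0 : (0 < L)%N by have := lenL true; lia.
have posS j : pos j.+1 = (pos j + len (ty j))%N by rewrite /pos big_ord_recr.
have pos_le j : (pos j <= j * L)%N.
  elim: j => [|j IH]; first by rewrite /pos big_ord0.
  by rewrite posS mulSn; have := lenL (ty j); lia.
have pos_gap j k : (j <= k)%N ->
    (k - j <= pos k - pos j)%N /\ (pos j <= pos k)%N.
  elim: k => [|k IH] jk; first by have -> : j = 0%N by lia.
  have [jk'|->] : (j <= k)%N \/ j = k.+1 by lia.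
    by have := IH jk'; have := lenL (ty k); rewrite posS; lia.
  by rewrite !subnn.
have pos_mono : {homo pos : a b / (a <= b)%N} by move=> a b /pos_gap[].
have /choice[x xP] : forall w : nat -> A, exists x, forall j i,
    (i < len (ty j))%N ->
    mdist (iter (pos j + i) T x) (W (ty j) (w j) i) < eps.
  move=> w.
  have [||u uo uW] := @pseudo_orbit_concat _ _ T delta
    (fun j => W (ty j) (w j)) (fun j => len (ty j)) z.
  - by move=> j; have := lenL (ty j); lia.
  - by move=> j; exact: Wpath.
  have [y yu] := shad u uo; exists y => j i ij.
  by rewrite -(uW j i ij).
have irr w : irregular_set T Phi (x w).
  pose f n := Phi (iter n T (x w)).
  have near_block j : `|\sum_(pos j <= i < pos j.+1) f i -
      \sum_(0 <= i < len (ty j)) Phi (W (ty j) (w j) i)| <=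
      th * (len (ty j))%:R.
    rewrite posS -{1}[pos j]add0n big_addn addKn -sumrB.
    apply: le_trans (ler_norm_sum _ _ _) _.
    rewrite mulr_natr -[X in th *+ X]subn0 -sumr_const_nat.
    apply: ler_sum_nat => i /andP[_ ilen]; apply/ltW/modPhi.
    by rewrite addnC; exact: xP.
  have phase p l : (2 ^ p <= l < 2 ^ p.+1)%N -> ty l = odd p.
    by move=> lp; rewrite /ty (trunc_log_eq _ lp).
  (* A phase of constant type occupies at least the share [1 / (2 * L)] of the
     time elapsed when it ends. *)
  have long p : [/\ (p <= pos (2 ^ p))%N, (pos (2 ^ p) < pos (2 ^ p.+1))%N &
      (pos (2 ^ p.+1) <= 2 * L * (pos (2 ^ p.+1) - pos (2 ^ p)))%N].
    have [p1 _] := pos_gap _ _ (leq0n (2 ^ p)%N).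
    have [p2 _] := pos_gap _ _ (leq_pexp2l (ltn0Sn 1) (leqnSn p)).
    have p3 : (0 < 2 ^ p)%N by rewrite expn_gt0.
    have p4 := ltn_expl p (ltnSn 1).
    have p5 := pos_le (2 ^ p.+1)%N.
    have p6 : pos 0%N = 0%N by rewrite /pos big_ord0.
    rewrite p6 subn0 in p1; rewrite expnS in p2 p5 *.
    split; [lia|lia|].
    apply: (leq_trans p5); rewrite -!mulnA leq_mul2l/= mulnC leq_mul2l.
    by apply/orP; right; lia.
  apply: (@birkhoff_oscillation _ f g th (2 * L)%N th0) => N.
    have [l1 l2 l3] := long (N.*2.+1).
    exists (pos (2 ^ N.*2.+1)%N), (pos (2 ^ N.*2.+2)%N); split=> //.
      by apply: leq_trans l1; lia.
    apply: sum_consecutive_ge => //; first by rewrite leq_exp2l.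
    move=> l lp; have tyl := phase _ _ lp; rewrite /= odd_double /= in tyl.
    have := near_block l; have := hi (w l); rewrite posS addKn tyl.
    by rewrite ler_norml => h /andP[h1 _]; lra.
  have [l1 l2 l3] := long (N.*2).
  exists (pos (2 ^ N.*2)%N), (pos (2 ^ N.*2.+1)%N); split=> //.
    by apply: leq_trans l1; lia.
  rewrite -lerN2 -sumrN -mulNr.
  apply: sum_consecutive_ge => //; first by rewrite leq_exp2l.
  move=> l lp; have tyl := phase _ _ lp; rewrite odd_double in tyl.
  have := near_block l; have := lo (w l); rewrite posS addKn tyl sumrN.
  by rewrite ler_norml => h /andP[_ h1]; lra.
apply: htop_at_ge => t ts; exists 0%N.
apply: (@lt_le_trans _ _ (expR (- (s * L%:R)))%:E).
  by rewrite lte_fin expR_gt0.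
apply: le_ereal_inf_tmp => _ [C [cC _ CE] <-].
(* A block has length at most [L], so a ball of order [v] determines at least
   the first [v %/ L] letters. *)
have := @kraft_cover R A _ C (fun p w => bowen_ball T p.1 p.2 eps (x w))
  (fun p => p.2 %/ L)%N A0.
have Qlen p w w' : C p -> bowen_ball T p.1 p.2 eps (x w) ->
    bowen_ball T p.1 p.2 eps (x w') ->
    forall i, (i < p.2 %/ L)%N -> w i = w' i.
  move=> _ /bowen_ballP -/(_ e0) pw /bowen_ballP -/(_ e0) pw' i iL.
  apply: contrapT => /(Wsep (ty i))[l llen sepl].
  have tp : (pos i + l < p.2)%N.
    have : (i.+1 * L <= p.2)%N.
      by apply: leq_trans (leq_divM p.2 L); rewrite leq_mul2r iL orbT.
    have := pos_le i.+1; rewrite posS; lia.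
  have d1 := xP w i l llen; have d2 := xP w' i l llen.
  have d3 := pw _ tp; have d4 := pw' _ tp.
  move: sepl; apply/negP; rewrite -ltNge.
  apply: le_lt_trans (metric_triangle _ (iter (pos i + l) T (x w)) _) _.
  have := metric_triangle (iter (pos i + l) T (x w)) (iter (pos i + l) T p.1)
    (W (ty i) (w' i) l).
  have := metric_triangle (iter (pos i + l) T p.1) (iter (pos i + l) T (x w'))
    (W (ty i) (w' i) l).
  rewrite (metric_sym (W _ _ _)) (metric_sym (iter _ T (x w)) (iter _ T p.1)).
  lra.
have Qcov w : exists2 p, C p & bowen_ball T p.1 p.2 eps (x w).
  by have [p Cp pw] := CE _ (irr w); exists p.
move=> /(_ Qlen Qcov); set k : R := #|A|%:R => kraft.
have E0 : 0 < expR (s * L%:R) by exact: expR_gt0.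
(* The factor [expR (s * L)] pays for the rounding in [v %/ L]. *)
have weight (p : X * nat) :
    k ^- (p.2 %/ L) <= expR (s * L%:R) * expR (- t * p.2%:R).
  set v := p.2; rewrite -expRD.
  apply: (@le_trans _ _ (expR (s * L%:R) ^- (v %/ L))).
    rewrite lef_pV2 ?posrE ?exprn_gt0// ?ltr0n//.
    by rewrite lerXn2r// ?nnegrE ?ler0n// ltW.
  rewrite -expRM_natl -expRN ler_expR.
  have vL : v%:R <= (v %/ L)%:R * L%:R + L%:R :> R.
    by rewrite -natrM -natrD ler_nat -mulSnr ltnW// ltn_ceil.
  have tv : t * v%:R <= s * v%:R by rewrite ler_wpM2r// ltW.
  have sv : s * v%:R <= s * ((v %/ L)%:R * L%:R + L%:R) by rewrite ler_wpM2l.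
  lra.
rewrite -(@lee_pmul2l _ (expR (s * L%:R))%:E)//.
rewrite -EFinM -expRD subrr expR0.
apply: (le_trans kraft); apply: le_trans _ (le_esumZ _ (ltW E0) _); last first.
  by move=> p; rewrite lee_fin expR_ge0.
by apply: le_esum => p _; rewrite -EFinM lee_fin.
Qed.
End Coding.

(** * Blocks made of a free loop and a tag loop *)

Lemma largest_fiber (I J : finType) (f : I -> J) : (0 < #|I|)%N ->
  exists2 j, (0 < #|[pred i | f i == j]|)%N &
    (#|I| <= #|J| * #|[pred i | f i == j]|)%N.
Proof.
move=> I0; have [i0 _] : exists i : I, true.
  by case/card_gt0P : I0 => i; exists i.
pose j := [arg max_(j > f i0) #|[pred i | f i == j]|].
have le_j : (#|I| <= #|J| * #|[pred i | f i == j]|)%N.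
  rewrite -[#|I|]sum1_card (partition_big f predT)//= -sum_nat_const.
  apply: leq_sum => j' _; rewrite sum1_card.
  by rewrite /j; case: arg_maxnP => //= j0 _ jmax; have := jmax j' isT.
exists j => //.
have := leq_trans I0 le_j.
by rewrite muln_gt0 => /andP[].
Qed.

(** A block consists of a free loop of about [K * m] steps, with orbit sum
within [m * g / 8] of [q], and of a tag loop of about [m] steps, with orbit sum
at least [m * c1]. Connecting chains change the sum by at most [4 * M * C], and
the length [len] by at most [4 * M]. The reference average, the first fraction
below, is that of a block with the intermediate tag [(c1 + c2) / 2]. Applied to
the opposites of all averages, the lemma bounds blocks with a low tag from
above. *)
Lemma block_sum_margin (R : realType) (m g K M C q c1 c2 len : R) :
    0 < m -> 1 <= K -> 0 < g -> g = c1 - c2 -> 0 <= M -> 0 < C ->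
    -C <= c1 <= C -> -C <= c2 <= C -> - (C * (K * m)) <= q <= C * (K * m) ->
    (K + 1) * m <= len <= (K + 1) * m + 4 * M ->
    64 * M * C <= m * g -> 4 * M <= m ->
  ((q + m * (c1 + c2) / 2) / ((K + 1) * m) + g / (8 * (K + 1))) * len <=
  q - m * g / 8 + m * c1 - 4 * M * C.
Proof.
move=> m0 K1 g0 gE M0 C0 c1C c2C qC lenb mMC mM.
have Km0 : 0 < (K + 1) * m by rewrite mulr_gt0//; lra.
set sg := q + _ / 2; set ga := sg / _.
have gaE : ga * ((K + 1) * m) = sg by rewrite /ga mulfVK// gt_eqF.
have gaC : ga <= C.
  rewrite /ga ler_pdivrMr// /sg.
  have : m * c1 <= m * C by rewrite ler_pM2l//; lra.
  have : m * c2 <= m * C by rewrite ler_pM2l//; lra.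
  lra.
have h1 : ga * len <= sg + 4 * M * C.
  rewrite (_ : len = (K + 1) * m + (len - (K + 1) * m)); last by ring.
  rewrite mulrDr gaE lerD2l.
  apply: (@le_trans _ _ (C * (len - (K + 1) * m))).
    by rewrite ler_wpM2r//; lra.
  rewrite mulrC ler_pM2r//; lra.
have h2 : g / (8 * (K + 1)) * len <= m * g / 4.
  apply: (@le_trans _ _ (g / (8 * (K + 1)) * (2 * ((K + 1) * m)))).
    rewrite ler_wpM2l//; first by rewrite divr_ge0 ?mulr_ge0//; lra.
    have : m <= K * m by rewrite ler_peMl// ltW.
    lra.
  by rewrite le_eqVlt; apply/orP; left; apply/eqP; field; apply/eqP; lra.
rewrite mulrDl; rewrite /sg in h1; rewrite gE in h2 mMC *; lra.
Qed.

Section Assembly.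
Context {R : realType} {X : metricType R}.
Implicit Types (T : X -> X) (x y z : X) (Phi : X -> R).

Lemma loop_sum T Phi delta z n a N w y (C : R) :
    loop_through T delta z n a N w y -> (forall x, `|Phi x| <= C) ->
  `|\sum_(0 <= i < N) Phi (w i) - \sum_(0 <= i < n) Phi (iter i T y)| <=
    C * (N - n)%:R.
Proof.
move=> [_ anN wa] PhiC.
have bnd p q (h : nat -> X) : `|\sum_(p <= i < q) Phi (h i)| <= C * (q - p)%:R.
  rewrite mulr_natr -sumr_const_nat; apply: le_trans (ler_norm_sum _ _ _) _.
  by apply: ler_sum => i _; exact: PhiC.
have aN : (a <= N)%N by lia.
rewrite (big_cat_nat (leq0n a) aN)/=.
have an : (a <= a + n)%N by lia.
rewrite (big_cat_nat an anN)/=.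
rewrite [X in _ + (X + _)](_ : _ =
  \sum_(0 <= i < n) Phi (iter i T y)); last first.
  rewrite -{1}[a]add0n big_addn addKn; apply: eq_big_nat => i /andP[_ ilt].
  by rewrite addnC wa.
have b1 := bnd 0%N a w; have b2 := bnd (a + n)%N N w.
rewrite (_ : (N - n = (a - 0) + (N - (a + n)))%N); last by lia.
rewrite natrD mulrDr.
set u := \sum_(0 <= i < a) _ in b1 *; set v := \sum_(a + n <= i < N) _ in b2 *.
rewrite (_ : u + (_ + v) - _ = u + v); last by ring.
by apply: le_trans (ler_normD _ _) _; exact: lerD.
Qed.

Lemma sum_cat_path Phi (u v : nat -> X) N N' :
  \sum_(0 <= i < N + N') Phi (cat_path u N v i) =
  \sum_(0 <= i < N) Phi (u i) + \sum_(0 <= i < N') Phi (v i).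
Proof.
rewrite (big_cat_nat (leq0n N) (leq_addr N' N))/=; congr (_ + _).
  by apply: eq_big_nat => i /andP[_ iN]; rewrite /cat_path iN.
rewrite -{1}[N]add0n big_addn addKn; apply: eq_big_nat => i _.
by rewrite /cat_path ltnNge leq_addl /= addnK.
Qed.

(** The order of the choices matters: [K] and [eps0] are given; they determine
the tolerance [th], then the shadowing scale [eps], then [delta] and the bound
[M] on connecting chains; [m] comes last, and makes these chains negligible.
The separated points are sorted by the offset and the length of their loops and
by the slot of width [m * g / 8] that contains their orbit sum. The number
[#|J|] of classes does not depend on [m], so that some class keeps the
exponential growth. When [s = 0], a single point suffices. *)
Lemma irregular_entropy_of_growth T Phi z (c1 c2 eps0 s : R) (K : nat) :
    compact [set: X] -> continuous T -> continuous Phi -> shadowing T ->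
    chain_recurrent T z -> c2 < c1 -> 0 < eps0 -> 0 <= s -> (0 < K)%N ->
    (forall m, (0 < m)%N -> exists2 y, chain_related T z y &
      c1 * m%:R <= \sum_(0 <= i < m) Phi (iter i T y)) ->
    (forall m, (0 < m)%N -> exists2 y, chain_related T z y &
      \sum_(0 <= i < m) Phi (iter i T y) <= c2 * m%:R) ->
    (forall (D : R) m0, exists m k (y : 'I_k -> X),
      [/\ (m0 <= m)%N, (0 < k)%N, forall i, chain_related T z (y i),
        bowen_separated T (K * m) eps0 y &
        s = 0 \/ D * expR (s * ((K%:R + 1) * m%:R)) <= k%:R]) ->
  exists2 eps, 0 < eps & (s%:E <= htop_at T (irregular_set T Phi) eps)%E.
Proof.
move=> cX cT cPhi shad zz c12 e0 s0 K0 tag1 tag2 growth.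
pose g := c1 - c2; have g0 : 0 < g by rewrite subr_gt0.
have KR : 1 <= K%:R :> R by rewrite ler1n.
pose th := g / (16 * (K%:R + 1)).
have th0 : 0 < th by rewrite divr_gt0// mulr_gt0//; lra.
have [r r0 rP] := uniform_modulus cX cPhi th0.
have [C C0 PhiC] := compact_bounded_fun cX cPhi.
pose eps := Num.min (eps0 / 4) r.
have eps_gt0 : 0 < eps by rewrite lt_min r0 divr_gt0.
exists eps => //.
have [delta d0 dP] := shad eps eps_gt0.
have [M MP] := exists_loop cX cT d0 zz.
pose B := Num.truncn (16 * C * K%:R / g).
pose J : finType := ('I_M.+1 * 'I_(2 * M).+1 * 'I_B.+1)%type.
pose m0 := (4 * M + (Num.truncn (64 * M%:R * C / g)).+1)%N.
have [m [k [y [m0m k0 yY ysep yk]]]] :=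
  growth (#|J|%:R * expR (s * (4 * M)%:R)) m0.
have mgt0 : (0 < m)%N by apply: leq_trans m0m; rewrite /m0 addnS.
have mR : 0 < m%:R :> R by rewrite ltr0n.
pose n := (K * m)%N.
have /choice[lp lpP] : forall i : 'I_k, exists l : nat * nat * (nat -> X),
    [/\ loop_through T delta z n l.1.1 l.1.2 l.2 (y i), (l.1.1 <= M)%N,
      (0 < l.1.2)%N & (l.1.2 <= n + 2 * M)%N].
  by move=> i; have [a [N [w H]]] := MP (y i) n (yY i); exists (a, N, w).
pose F i := \sum_(0 <= l < n) Phi (iter l T (y i)).
have FC i : - (C * (K%:R * m%:R)) <= F i <= C * (K%:R * m%:R).
  rewrite -ler_norml -natrM mulr_natr -[(K * m)%N]subn0 -sumr_const_nat.
  by apply: le_trans (ler_norm_sum _ _ _) _; apply: ler_sum.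
have mg0 : 0 < m%:R * g by rewrite mulr_gt0.
pose scaled i := (F i + C * (K%:R * m%:R)) * 8 / (m%:R * g).
have scaled0 i : 0 <= scaled i.
  by rewrite divr_ge0 ?(ltW mg0)// mulr_ge0//; have /andP[] := FC i; lra.
have scaledB i : (Num.truncn (scaled i) <= B)%N.
  apply: le_truncn; rewrite /scaled ler_pdivrMr//.
  rewrite (_ : 16 * C * K%:R / g * (m%:R * g) = 16 * C * K%:R * m%:R);
    last first.
    by field; rewrite gt_eqF.
  by have /andP[_] := FC i; lra.
pose f i : J := (inord (lp i).1.1, inord ((lp i).1.2 - n)%N,
                 inord (Num.truncn (scaled i))).
have [j fib0 fibk] : exists2 j, (0 < #|[pred i | f i == j]|)%N &
    (k <= #|J| * #|[pred i | f i == j]|)%N.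
  by have := @largest_fiber 'I_k J f; rewrite card_ord => /(_ k0).
pose A : finType := {i : 'I_k | f i == j}.
have cardA : #|A| = #|[pred i | f i == j]| by rewrite card_sig.
have A0 : (0 < #|A|)%N by rewrite cardA.
have [a0 _] : exists a : A, true by case/card_gt0P : A0 => a; exists a.
have sameA (a b : A) : [/\ (lp (val a)).1.1 = (lp (val b)).1.1,
    (lp (val a)).1.2 = (lp (val b)).1.2 &
    Num.truncn (scaled (val a)) = Num.truncn (scaled (val b))].
  have /eqP : f (val a) = f (val b).
    by rewrite (eqP (valP a)) (eqP (valP b)).
  rewrite /f !xpair_eqE -!val_eqE /=.
  have [[_ an _] a1 a2 a3] := lpP (val a).
  have [[_ bn _] b1 b2 b3] := lpP (val b).
  have aB := scaledB (val a); have bB := scaledB (val b).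
  rewrite !inordK ?ltnS ?leq_subLR//.
  move=> /andP[/andP[/eqP -> /eqP e] /eqP ->]; split => //.
  have an' := leq_trans (leq_addl _ _) an.
  have bn' := leq_trans (leq_addl _ _) bn.
  by rewrite -(subnK an') e subnK.
pose N := (lp (val a0)).1.2; pose off := (lp (val a0)).1.1.
pose q := F (val a0).
have Fq (a : A) : `|F (val a) - q| <= m%:R * g / 8.
  have [_ _ tr] := sameA a a0.
  have /andP[l1 l2] := truncn_itv (scaled0 (val a)).
  have /andP[l3 l4] := truncn_itv (scaled0 (val a0)).
  rewrite tr in l1 l2; rewrite -!natr1 in l2 l4.
  have : `|scaled (val a) - scaled (val a0)| <= 1.
    rewrite ler_norml; move: l1 l2 l3 l4; clear => l1 l2 l3 l4.
    by apply/andP; split; lra.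
  rewrite (_ : scaled (val a) - scaled (val a0) =
    (F (val a) - q) * (8 / (m%:R * g))).
    rewrite normrM (gtr0_norm (_ : 0 < 8 / (m%:R * g))) ?divr_gt0//.
    by rewrite mulrA ler_pdivrMr// mul1r -ler_pdivlMr.
  by rewrite /scaled /q; field; rewrite !gt_eqF.
have [y1 y1Y y1S] := tag1 m mgt0; have [y2 y2Y y2S] := tag2 m mgt0.
have [a1 [N1 [w1 [lp1 _ N10 N1M]]]] := MP y1 m y1Y.
have [a2 [N2 [w2 [lp2 _ N20 N2M]]]] := MP y2 m y2Y.
pose W (b : bool) (a : A) := cat_path (lp (val a)).2 N (if b then w1 else w2).
pose len (b : bool) := (N + if b then N1 else N2)%N.
have loopA (a : A) : loop_through T delta z n off N (lp (val a)).2 (y (val a)).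
  by have [e1 e2 _] := sameA a a0; have [+ _ _ _] := lpP (val a); rewrite e1 e2.
have [nN N0 NM] : [/\ (n <= N)%N, (0 < N)%N & (N <= n + 2 * M)%N].
  have [[_ anN _] _ ? ?] := lpP (val a0); split => //.
  exact: leq_trans (leq_addl _ _) anN.
have mN1 : (m <= N1)%N by case: lp1 => _ /(leq_trans (leq_addl _ _)).
have mN2 : (m <= N2)%N by case: lp2 => _ /(leq_trans (leq_addl _ _)).
pose ga := (q + m%:R * (c1 + c2) / 2) / ((K%:R + 1) * m%:R).
have c1C : c1 <= C.
  rewrite -(ler_pM2r mR); apply: (le_trans y1S).
  rewrite mulr_natr -[X in _ *+ X]subn0 -sumr_const_nat; apply: ler_sum => i _.
  by apply: le_trans (ler_norm _) _.
have c2C : - C <= c2.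
  rewrite -(ler_pM2r mR); apply: le_trans y2S.
  rewrite mulr_natr -[X in _ *+ X]subn0 -sumr_const_nat; apply: ler_sum => i _.
  by rewrite lerNl; apply: le_trans (ler_norm _) _; rewrite normrN.
have c1b : - C <= c1 <= C by rewrite c1C (le_trans c2C (ltW c12)).
have c2b : - C <= c2 <= C by rewrite c2C (le_trans (ltW c12) c1C).
have flip (c v : R) : - v <= c <= v -> - v <= - c <= v.
  by move=> /andP[? ?]; rewrite lerN2 lerNl; apply/andP; split.
have qC := FC (val a0); rewrite -/q in qC.
have n_R : n%:R = K%:R * m%:R :> R by rewrite natrM.
have lenR b : (K%:R + 1) * m%:R <= ((len b)%:R : R) <=
    (K%:R + 1) * m%:R + 4 * M%:R.
  rewrite mulrDl mul1r -n_R -natrM -!natrD !ler_nat /len.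
  by move: nN NM mN1 mN2 N1M N2M; clear; case: b; lia.
have mM : 4 * M%:R <= m%:R :> R.
  by rewrite -natrM ler_nat (leq_trans _ m0m)// /m0 leq_addr.
have mMC : 64 * M%:R * C <= m%:R * g.
  rewrite -ler_pdivrMr//; apply/ltW/(lt_le_trans (truncnS_gt _)).
  by rewrite ler_nat (leq_trans _ m0m)// /m0 leq_addl.
have th2 : 2 * th = g / (8 * (K%:R + 1)).
  by rewrite /th; field; rewrite gt_eqF//; lra.
have freeC (a : A) :
    `|\sum_(0 <= i < N) Phi ((lp (val a)).2 i) - F (val a)| <= 2 * M%:R * C.
  apply: le_trans (loop_sum (loopA a) PhiC) _.
  rewrite mulrC ler_pM2r// -natrM ler_nat leq_subLR; exact: NM.
have tagC1 := loop_sum lp1 PhiC; have tagC2 := loop_sum lp2 PhiC.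
have {}tagC1 : `|\sum_(0 <= i < N1) Phi (w1 i) -
    \sum_(0 <= i < m) Phi (iter i T y1)| <= 2 * M%:R * C.
  apply: le_trans tagC1 _.
  rewrite mulrC ler_pM2r// -natrM ler_nat leq_subLR; exact: N1M.
have {}tagC2 : `|\sum_(0 <= i < N2) Phi (w2 i) -
    \sum_(0 <= i < m) Phi (iter i T y2)| <= 2 * M%:R * C.
  apply: le_trans tagC2 _.
  rewrite mulrC ler_pM2r// -natrM ler_nat leq_subLR; exact: N2M.
apply: (@coded_irregular_entropy _ _ T Phi A W len z delta eps s ga th
  (n + m + 4 * M)%N) => //.
- move=> u v uv; apply: rP; apply: lt_le_trans uv _.
  by rewrite ge_min lexx orbT.
- move=> b a; have [pA _ _] := loopA a.
  by case: b; [case: lp1|case: lp2] => pt _ _; exact: chain_path_cat pA pt.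
- move=> b; rewrite /len; apply/andP; split; first by rewrite addn_gt0 N0.
  by move: NM N1M N2M; clear; case: b; lia.
- move=> b a a' aa'.
  have /ysep[l ln sepl] : val a <> val a' by move=> /val_inj.
  have [_ oN wl] := loopA a; have [_ _ wl'] := loopA a'.
  have lN : (off + l < N)%N by apply: leq_trans oN; rewrite ltn_add2l.
  exists (off + l)%N; first by rewrite /len (leq_trans lN)// leq_addr.
  rewrite /W /cat_path lN wl// wl'//; apply: le_trans sepl.
  by rewrite mulrC -ler_pdivlMr// ge_min lexx.
- move=> a; rewrite sum_cat_path th2.
  apply: le_trans (block_sum_margin mR KR g0 (erefl g) (ler0n _ M) C0 c1b c2b qC
    (lenR true) mMC mM) _.
  move: (Fq a) (freeC a) tagC1 y1S; rewrite !ler_norml; clear.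
  by move=> /andP[? ?] /andP[? ?] /andP[? ?] ?; lra.
- move=> a; rewrite sum_cat_path th2 -lerN2.
  have gE : g = - c2 - - c1 by rewrite /g; ring.
  have gaN : (- q + m%:R * (- c2 + - c1) / 2) / ((K%:R + 1) * m%:R) = - ga.
    by rewrite /ga -mulNr; congr (_ / _); field.
  rewrite -mulNr opprB [_ - ga]addrC -gaN.
  apply: le_trans (block_sum_margin mR KR g0 gE (ler0n _ M) C0 (flip _ _ c2b)
    (flip _ _ c1b) (flip _ _ qC) (lenR false) mMC mM) _.
  move: (Fq a) (freeC a) tagC2 y2S; rewrite !ler_norml; clear.
  by move=> /andP[? ?] /andP[? ?] /andP[? ?] ?; lra.
rewrite cardA; case: yk => [->|yk]; first by rewrite mul0r expR0 ler1n.
have J0 : 0 < #|J|%:R :> R by rewrite ltr0n !card_prod !card_ord.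
rewrite -(ler_pM2l J0) -natrM.
apply: (@le_trans _ _ k%:R); last by rewrite ler_nat.
apply: le_trans yk; rewrite -mulrA ler_pM2l// -expRD ler_expR -mulrDr.
by rewrite ler_wpM2l// mulrDl mul1r -n_R -!natrD ler_nat addnC.
Qed.
End Assembly.

(** * Separated sets in the class, and the theorem *)

(** Pick [t] strictly between [s] and the entropy of [Y]. For [K] large the
exponent [t * (K * m)] of the size of separated sets exceeds
[s * ((K + 1) * m)] by a multiple of [m], which absorbs any constant [D]. *)
Lemma entropy_growth (R : realType) (X : metricType R) (T : X -> X)
    (Y : set X) (s : R) :
    0 <= s -> (s%:E < htop T Y)%E ->
  exists2 eps : R, 0 < eps & exists2 K, (0 < K)%N &
    forall (D : R) m0, exists m k (y : 'I_k -> X),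
      [/\ (m0 <= m)%N, (0 < k)%N, forall i, Y (y i),
        bowen_separated T (K * m) eps y &
        D * expR (s * ((K%:R + 1) * m%:R)) <= k%:R].
Proof.
move=> s0; rewrite htopE => /ereal_sup_gt[_ [eps /= e0 <-]].
move=> /ereal_between[t]; rewrite lte_fin => st /htop_at_gt[c c0 [n0 cn]].
exists eps => //.
have ts : 0 < t - s by rewrite subr_gt0.
pose K := (Num.truncn (s / (t - s))).+1.
have K1 : 1 <= K%:R :> R by rewrite ler1n.
have kap0 : 0 < t * K%:R - s * (K%:R + 1).
  have : s / (t - s) < K%:R by exact: truncnS_gt.
  by rewrite ltr_pdivrMr//; lra.
set kap := t * _ - _ in kap0.
exists K => // D m0.
pose m := (maxn (maxn m0 n0) (Num.truncn (`|D| / (c * kap))).+1)%N.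
have m0m : (m0 <= m)%N by rewrite /m !leq_max leqnn.
have n0m : (n0 <= m)%N by rewrite /m !leq_max leqnn orbT.
have Dm : `|D| <= c * kap * m%:R.
  rewrite mulrC -ler_pdivrMr ?mulr_gt0//.
  apply/ltW/(lt_le_trans (truncnS_gt _)).
  by rewrite ler_nat /m leq_max leqnn orbT.
have nK : (n0 <= K * m)%N by rewrite (leq_trans n0m)// leq_pmull.
have [k [y [yY ysep yk]]] := separated_family e0 c0 (cn _ nK).
exists m, k, y; split => //.
  by rewrite -(ltr_nat R); apply: lt_le_trans yk; rewrite mulr_gt0// expR_gt0.
apply: le_trans yk; apply: le_trans (ler_norm _) _.
rewrite normrM (gtr0_norm (expR_gt0 _)).
rewrite (_ : t * (K * m)%:R = kap * m%:R + s * ((K%:R + 1) * m%:R)); last first.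
  by rewrite natrM /kap; ring.
rewrite expRD [c * (_ * _)]mulrA ler_pM2r ?expR_gt0//; apply: (le_trans Dm).
rewrite -mulrA ler_pM2l//; apply: le_trans (expR_ge1Dx _).
by rewrite lerDr.
Qed.

Theorem theorem3p1 (R : realType) (X : pointedMetricType R) (T : X -> X)
    (compactX : compact [set: X]) (continuousT : continuous T)
    (shadowingT : shadowing T)
    (Y : set X) (classY : chain_recurrent_class T Y)
    (Phi : X -> R) (continuousPhi : continuous Phi)
    (mu1mu2 : exists mu1 mu2 : probability (borelType X) R,
      [/\ ergodic_measures T Y mu1, ergodic_measures T Y mu2 &
        (\int[mu1]_x (Phi x)%:E)%E <> (\int[mu2]_x (Phi x)%:E)%E]) :
  (htop T Y <= htop T (irregular_set T Phi))%E.
Proof.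
have [z zY YE] := chain_recurrent_classE classY; subst Y.
set Y := [set y | _] in zY *.
have clY : closed Y := chain_class_closed continuousT.
have [mu1 [mu2 [[inv1 _ mu1Y] [inv2 _ mu2Y] lt21]]] :
    exists mu1 mu2 : probability (borelType X) R,
      [/\ ergodic_measures T Y mu1, ergodic_measures T Y mu2 &
        (\int[mu2]_x (Phi x)%:E < \int[mu1]_x (Phi x)%:E)%E].
  case: mu1mu2 => mu1 [mu2 [h1 h2 /eqP]]; rewrite neq_lt => /orP[h|h].
    by exists mu2, mu1.
  by exists mu1, mu2.
have [c /ereal_between[c2 c2lo c2c] /ereal_between[c1 cc1 c1hi]] :=
  ereal_between lt21.
have c21 : c2 < c1 by rewrite -lte_fin; exact: lt_trans c2c cc1.
have tag1 m : (0 < m)%N -> exists2 y, Y y &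
    c1 * m%:R <= \sum_(0 <= i < m) Phi (iter i T y).
  exact: invariant_orbit_sum c1hi.
have tag2 m : (0 < m)%N -> exists2 y, Y y &
    \sum_(0 <= i < m) Phi (iter i T y) <= c2 * m%:R.
  move=> m0.
  have cN : continuous (fun x => - Phi x).
    by move=> x; exact: cvgN (continuousPhi x).
  have c2lt : ((- c2)%:E < \int[mu2]_x (- Phi x)%:E)%E.
    rewrite (_ : (\int[mu2]_x (- Phi x)%:E = - \int[mu2]_x (Phi x)%:E)%E).
      by rewrite EFinN lteN2.
    rewrite -mulN1e -integralZl//; last exact: continuous_borel_integrable.
    by apply: eq_integral => x _; rewrite -EFinM mulN1r.
  have [y yY yS] :=
    invariant_orbit_sum compactX continuousT cN inv2 clY mu2Y c2lt m0.
  by exists y => //; rewrite -lerN2 -mulNr -sumrN.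
have lower (s : R) : 0 <= s -> s = 0 \/ (s%:E < htop T Y)%E ->
    (s%:E <= htop T (irregular_set T Phi))%E.
  move=> s0 sY.
  suff [e [K [e0 K0 growth]]] : exists e K, [/\ 0 < e, (0 < K)%N &
      forall (D : R) m0, exists m k (y : 'I_k -> X),
        [/\ (m0 <= m)%N, (0 < k)%N, forall i, Y (y i),
          bowen_separated T (K * m) e y &
          s = 0 \/ D * expR (s * ((K%:R + 1) * m%:R)) <= k%:R]].
    have [eps eps0 htop_eps] := irregular_entropy_of_growth compactX continuousT
      continuousPhi shadowingT zY c21 e0 s0 K0 tag1 tag2 growth.
    rewrite htopE; apply: le_ereal_sup_tmp.
    by exists (htop_at T (irregular_set T Phi) eps) => //; exists eps.
  case: sY => [->|/(entropy_growth s0)[e e0 [K K0 growth]]]; last first.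
    exists e, K; split=> // D m0; have [m [k [y [? ? ? ? ?]]]] := growth D m0.
    by exists m, k, y; split => //; right.
  exists 1, 1%N; split => // D m0; exists m0, 1%N, (fun=> z); split => //.
  - by move=> i j; rewrite !ord1.
  - by left.
rewrite leNgt; apply/negP => /ereal_between[s Is sY].
have [s0|s0] := leP 0 s.
  by move: Is; apply/negP; rewrite -leNgt; apply: lower => //; right.
move: Is; apply/negP; rewrite -leNgt; apply: le_trans (lower 0 _ _) => //.
  by rewrite lee_fin ltW.
by left.
Qed.
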